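(* Let $k\ge 2$ be a constant. Every deterministic $\mathsf{Online}$-$\mathsf{LOCAL}$ algorithm that properly colors every $n$-node $k$-partite graph using at most $2k-2$ colors has locality $\Omega(n)$.
   Context: A graph is $k$-partite if it admits a proper coloring with $k$ colors. For a graph $G=(V,E)$, $U\subseteq V$ and an integer $T\ge 0$, $\mathcal{B}(U,T)$ denotes the set of nodes at distance at most $T$ from some node of $U$, and $G[U]$ denotes the induced subgraph. The $\mathsf{Online}$-$\mathsf{LOCAL}$ model: an algorithm with locality $T=T(n)$ is deterministic and knows $n$. The adversary chooses an $n$-node input graph $G=(V,E)$ from the input family, assigns distinct identifiers from $\{1,\dots,\mathrm{poly}(n)\}$ to its nodes, and chooses an ordering $\sigma=(v_1,\dots,v_n)$ of $V$. For $i=1,\dots,n$, when $v_i$ is presented, the algorithm must irrevocably assign an output (here a color) to $v_i$ as a function of the sequence $(v_1,\dots,v_i)$ and the induced subgraph $G_i=G\big[\bigcup_{j\le i}\mathcal{B}(v_j,T)\big]$ (with identifiers); thus the algorithm has global memory of everything seen so far. The algorithm solves a coloring problem on an input family if for every choice of the adversary the final coloring is proper and uses only the allowed colors. The locality of a problem is the minimum locality of an algorithm solving it. *)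

(* Defs.v *)
From mathcomp Require Import all_boot.
Set Implicit Arguments. Unset Strict Implicit. Unset Printing Implicit Defensive.

Definition simple_graph (n : nat) (G : rel 'I_n) : Prop :=
  symmetric G /\ irreflexive G.

Definition kpartite (k n : nat) (G : rel 'I_n) : Prop :=
  exists f : 'I_n -> 'I_k, forall u v, G u v -> f u != f v.

Definition within (n : nat) (G : rel 'I_n) (T : nat) (u v : 'I_n) : Prop :=
  exists p : seq 'I_n, [/\ path G u p, last u p = v & size p <= T].

(* What the algorithm sees: only identifiers.
   vseq  = identifiers of the presented nodes v_1, ..., v_i (in order),
   vnodes x <-> some node of G_i has identifier x,
   vedges x y <-> G_i has an edge between the nodes with identifiers x, y. *)
Record View := MkView {
  vseq : seq nat;
  vnodes : nat -> Prop;
  vedges : nat -> nat -> Prop }.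

(* An algorithm (for a fixed n, locality T) maps views to colors. *)
Definition algorithm := View -> nat.

(* Node w belongs to B({v_0..v_i}, T), with v_j = sigma j (steps 0-indexed). *)
Definition visible (n : nat) (G : rel 'I_n) (T : nat) (sigma : 'I_n -> 'I_n)
  (i : 'I_n) (w : 'I_n) : Prop :=
  exists j : 'I_n, j <= i /\ within G T (sigma j) w.

Definition view (n : nat) (G : rel 'I_n) (T : nat) (ids : 'I_n -> nat)
  (sigma : 'I_n -> 'I_n) (i : 'I_n) : View :=
  MkView (map (fun j : 'I_n => ids (sigma j)) (filter (fun j : 'I_n => (j <= i)%N) (enum 'I_n)))
    (fun x => exists w, visible G T sigma i w /\ ids w = x)
    (fun x y => exists u w, [/\ visible G T sigma i u, visible G T sigma i w,
                               G u w, ids u = x & ids w = y]).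

Definition solves_coloring (k m n c T : nat) (A : algorithm) : Prop :=
  forall G : rel 'I_n, simple_graph G -> kpartite k G ->
  forall ids : 'I_n -> nat, injective ids -> (forall v, 1 <= ids v <= n ^ c) ->
  forall sigma : 'I_n -> 'I_n, injective sigma ->
  (forall i, A (view G T ids sigma i) < m) /\
  (forall i j, G (sigma i) (sigma j) ->
     A (view G T ids sigma i) != A (view G T ids sigma j)).

(* Main.v *)
Require Import Defs.
From mathcomp Require Import all_boot.
From mathcomp Require Import zify.
From Stdlib Require Import FunctionalExtensionality PropExtensionality.
Set Implicit Arguments. Unset Strict Implicit. Unset Printing Implicit Defensive.

(** In the tensor product of two [k]-cliques, viewed as a [k * k] grid, every
    independent set lies in a row or in a column. Counting colors, a coloring with
    [2k - 2] colors repeats a color either in every row or in every column, but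
    never both; this alternative cannot change when one row is recolored. Hence it
    is constant along a strip whose windows of [k] consecutive rows are all such
    grids. The strip can be completed at its far end so that rows become rainbow,
    or so that columns do; both completions are [k]-partite, and they force opposite
    alternatives on the first window, which the algorithm colors before it can
    tell the completions apart. *)

(** * Rainbow rows and columns of a properly colored grid *)

Definition grid_proper (k m : nat) (c : 'I_k -> 'I_k -> 'I_m) : Prop :=
  forall a a' b b', a != a' -> b != b' -> c a b != c a' b'.

Definition transpose (k m : nat) (c : 'I_k -> 'I_k -> 'I_m) := fun b a => c a b.

Definition rainbow_rows (k m : nat) (c : 'I_k -> 'I_k -> 'I_m) : {set 'I_k} :=
  [set a | injectiveb (c a)].

(** The default [a] is a mere filler of type ['I_k]: the value is meaningful only when row [a]
    repeats a color. *)
Definition repeated_color (k m : nat) (c : 'I_k -> 'I_k -> 'I_m) (a : 'I_k) : 'I_m :=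
  c a (odflt a [pick b | [exists b', (b != b') && (c a b == c a b')]]).

Lemma grid_proper_transpose (k m : nat) (c : 'I_k -> 'I_k -> 'I_m) :
  grid_proper c -> grid_proper (transpose c).
Proof. by move=> cP a a' b b' ab bb; apply: cP. Qed.

Lemma repeated_colorP (k m : nat) (c : 'I_k -> 'I_k -> 'I_m) (a : 'I_k) :
  ~~ injectiveb (c a) ->
  exists b b', [/\ b != b', c a b = repeated_color c a & c a b' = repeated_color c a].
Proof.
rewrite /repeated_color => /injectivePn[b [b' ne e]].
case: pickP => [b1 /existsP[b2 /andP[ne' /eqP eqc]]|/(_ b)/existsP[]]; first by exists b1, b2.
by exists b'; rewrite ne e eqxx.
Qed.

(** A cell of this color outside row [a] would have to share its column with both occurrences in row
    [a]. *)
Lemma repeated_color_row (k m : nat) (c : 'I_k -> 'I_k -> 'I_m) (a a' b' : 'I_k) :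
  grid_proper c -> ~~ injectiveb (c a) -> c a' b' = repeated_color c a -> a' = a.
Proof.
move=> cP /repeated_colorP[b1 [b2 [ne e1 e2]]] e; apply/eqP/contraT => nea.
have same_col b : c a b = repeated_color c a -> b = b'.
  move=> eb; apply/eqP/contraT => nb.
  by move: (cP _ _ _ _ nea (contra_neq esym nb)); rewrite e eb eqxx.
by move: ne; rewrite (same_col _ e1) (same_col _ e2) eqxx.
Qed.

(* A color used twice in a row lives in that row only, and likewise for columns;
   the cells in a rainbow row and a rainbow column get pairwise distinct further
   colors. *)
Lemma rainbow_count (k m : nat) (c : 'I_k -> 'I_k -> 'I_m) :
  grid_proper c ->
  #|~: rainbow_rows c| + #|~: rainbow_rows (transpose c)|
  + #|rainbow_rows c| * #|rainbow_rows (transpose c)| <= m.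
Proof.
move=> cP; have tP := grid_proper_transpose cP.
set X := rainbow_rows c; set Y := rainbow_rows _.
pose f (p : 'I_k * 'I_k) := c p.1 p.2.
have injX : {in ~: X &, injective (repeated_color c)}.
  move=> a a'; rewrite !inE => ra ra' e.
  have [b [_ [_ eb _]]] := repeated_colorP ra.
  by apply: (repeated_color_row (b' := b) cP ra'); rewrite eb.
have injY : {in ~: Y &, injective (repeated_color (transpose c))}.
  move=> a a'; rewrite !inE => ra ra' e.
  have [b [_ [_ eb _]]] := repeated_colorP ra.
  by apply: (repeated_color_row (b' := b) tP ra'); rewrite eb.
have injf : {in setX X Y &, injective f}.
  move=> [a b] [a' b']; rewrite !inE /f /= => /andP[/injectiveP ra /injectiveP rb] _ e.
  have [ea|na] := eqVneq a a'.
    by rewrite -ea in e *; rewrite (ra _ _ e).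
  have [eb|nb] := eqVneq b b'; last by move/eqP: e; rewrite (negbTE (cP _ _ _ _ na nb)).
  by rewrite -eb in e *; rewrite (rb _ _ e).
rewrite -(card_in_imset injX) -(card_in_imset injY) -cardsX -(card_in_imset injf).
set A := _ @: ~: X; set B := _ @: ~: Y; set C := f @: _.
have dAB : [disjoint A & B].
  rewrite -setI_eq0; apply/set0Pn => -[z /setIP[/imsetP[a]]].
  rewrite !inE => ra -> /imsetP[b]; rewrite !inE.
  move=> /repeated_colorP[a1 [a2 [ne e1 e2]]] e.
  (* A color repeated both in row [a] and in column [b] would force the distinct cells [a1], [a2] of
     that column into row [a]. *)
  move: ne; rewrite (repeated_color_row (b' := b) cP ra (etrans e1 (esym e))).
  by rewrite (repeated_color_row (b' := b) cP ra (etrans e2 (esym e))) eqxx.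
have dABC : [disjoint A :|: B & C].
  rewrite -setI_eq0; apply/set0Pn => -[z /setIP[zAB /imsetP[[a b]]]].
  rewrite !inE /= => /andP[ra rb] ez.
  case/setUP: zAB => /imsetP[d]; rewrite !inE ez => rd e.
  - by move: (rd); rewrite -(repeated_color_row cP rd e) ra.
  - by move: (rd); rewrite -(repeated_color_row (a' := b) (b' := a) tP rd e) rb.
have /eqP <- : #|A :|: B| == #|A| + #|B| by rewrite (leq_card_setU A B).2.
have /eqP <- : #|A :|: B :|: C| == #|A :|: B| + #|C| by rewrite (leq_card_setU _ C).2.
by rewrite -[leqRHS](card_ord m) max_card.
Qed.

(** Over the integers, [rainbow_count] becomes [(x - 1) * (y - 1) <= -1]. *)
Lemma rainbow_dichotomy (k : nat) (c : 'I_k -> 'I_k -> 'I_(2 * k - 2)) :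
  0 < k -> grid_proper c ->
  let x := #|rainbow_rows c| in let y := #|rainbow_rows (transpose c)| in
  x = 0 /\ 1 < y \/ y = 0 /\ 1 < x.
Proof.
move=> k0 /rainbow_count /=.
have := cardsC (rainbow_rows c); have := cardsC (rainbow_rows (transpose c)).
rewrite card_ord; move: #|rainbow_rows _| #|rainbow_rows c| => y x.
move: #|_| #|_| => y' x' Hy Hx H.
case: x Hx H => [|[|x]] Hx H; case: y Hy H => [|[|y]] Hy H; nia.
Qed.

(** * Sliding a window of [k] rows *)

Definition window (k m : nat) (c : nat -> 'I_k -> 'I_m) (j : nat) : 'I_k -> 'I_k -> 'I_m :=
  fun a => c (j + a).

(** The two windows share [k - 1] rows, so if one has no rainbow row, the other has at most one;
    [rainbow_dichotomy] rules out exactly one. *)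
Lemma window_step (k : nat) (c : nat -> 'I_k -> 'I_(2 * k - 2)) (j : nat) :
  0 < k -> grid_proper (window c j) -> grid_proper (window c j.+1) ->
  (rainbow_rows (window c j) == set0) = (rainbow_rows (window c j.+1) == set0).
Proof.
move=> k0 /(rainbow_dichotomy k0) D /(rainbow_dichotomy k0) D'.
have k1 : k.-1 < k by rewrite prednK.
rewrite -!cards_eq0; apply/eqP/eqP => /cards0_eq E.
- have : rainbow_rows (window c j.+1) \subset [set Ordinal k1].
    apply/subsetP => a; rewrite !inE -val_eqE /= => ra; apply/contraT => na.
    have a1 : a.+1 < k by have := ltn_ord a; lia.
    have := in_set0 (Ordinal a1); rewrite -E inE /window /= addnS.
    by rewrite /window addSn in ra; rewrite ra.
  by move/subset_leq_card; rewrite cards1; lia.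
- have : rainbow_rows (window c j) \subset [set Ordinal k0].
    apply/subsetP => a; rewrite !inE -val_eqE /= => ra; apply/contraT => na.
    have a1 : a.-1 < k by have := ltn_ord a; lia.
    have := in_set0 (Ordinal a1); rewrite -E inE /window /= addSn -addnS prednK ?lt0n //.
    by rewrite /window in ra; rewrite ra.
  by move/subset_leq_card; rewrite cards1; lia.
Qed.

Lemma window_invariant (k R : nat) (c : nat -> 'I_k -> 'I_(2 * k - 2)) :
  0 < k -> (forall j, j <= R -> grid_proper (window c j)) ->
  (rainbow_rows (window c 0) == set0) = (rainbow_rows (window c R) == set0).
Proof.
move=> k0; elim: R => [|R IH] cP //.
by rewrite IH => [|j jR]; [apply: window_step => //; apply: cP | apply: cP; apply: leqW].
Qed.

(* Node [u] sits in row [u %/ k] and column [u %% k], and any [k] consecutive rows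
   induce the tensor product of two [k]-cliques. From row [R] on, one of the two
   inequalities is dropped, so that the columns ([o = true]) or the residues of
   the rows ([o = false]) become the only [k]-coloring. *)
Definition strip (k R : nat) (o : bool) (u v : nat) : bool :=
  [&& u %/ k < v %/ k + k, v %/ k < u %/ k + k &
   if (R <= u %/ k) && (R <= v %/ k) then
     if o then u %% k != v %% k else u %/ k != v %/ k
   else (u %/ k != v %/ k) && (u %% k != v %% k)].

Definition strip_graph (k R : nat) (o : bool) (n : nat) : rel 'I_n :=
  fun u v => strip k R o u v.

Lemma strip_graph_simple (k R : nat) (o : bool) (n : nat) :
  simple_graph (@strip_graph k R o n).
Proof.
split=> [u v|u]; rewrite /strip_graph /strip; last first.
  by rewrite !eqxx /= ?if_same !andbF; case: o; rewrite ?if_same ?andbF.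
by rewrite andbCA (andbC (R <= u %/ k)) (eq_sym (u %% k)) (eq_sym (u %/ k)).
Qed.

Lemma strip_graph_kpartite (k R : nat) (o : bool) (n : nat) :
  0 < k -> kpartite k (@strip_graph k R o n).
Proof.
move=> k0; pose col (u : 'I_n) := if o then u %% k else u %/ k %% k.
have colP u : col u < k by rewrite /col; case: ifP; rewrite ltn_mod.
exists (fun u => Ordinal (colP u)) => u v; rewrite -val_eqE /= /strip_graph /strip /col.
case/and3P=> uv vu H.
have : if o then u %% k != v %% k else u %/ k != v %/ k.
  by move: H; case: ifP => _ //; case: o {col colP} => /andP[].
case: o {H col colP} => // ne; apply: contra ne => /eqP e.
(* Rows congruent modulo [k] and less than [k] apart coincide. *)
move: uv vu e; move: (u %/ k) (v %/ k) => r s rs sr e; apply/eqP.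
wlog le_rs : r s rs sr e / r <= s.
  by move=> W; case/orP: (leq_total r s) => ?; [|apply: esym]; apply: W.
have /eqP := esym e; rewrite eqn_mod_dvd // => /dvdnP[[|q]]; nia.
Qed.

(* Each edge climbs fewer than [k] rows, so radius [T] around the first [k] rows
   does not show where the two strips differ. *)
Lemma strip_path_eq (k T : nat) (o o' : bool) (n : nat) (u : 'I_n) (p : seq 'I_n) (s : nat) :
  path (strip_graph k (k * T.+1) o (n := n)) u p -> u %/ k < k * s.+1 -> s + size p <= T ->
  path (strip_graph k (k * T.+1) o' (n := n)) u p /\ last u p %/ k < k * T.+1.
Proof.
(* Here [s] counts the edges already walked; each one raises the row bound by [k]. *)
elim: p u s => [|v p IH] u s /=.
  by move=> _ us; rewrite addn0 => sT; split=> //; apply: leq_trans us _; rewrite leq_mul2l ltnS sT orbT.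
case/andP=> e ep us; rewrite addnS -addSn => sT.
have uT : u %/ k < k * T.+1 by apply: leq_trans us _; rewrite leq_mul2l; lia.
have vs : v %/ k < k * s.+2 by case/and3P: e => _ v1 _; rewrite mulnS; lia.
have [-> ->] := IH v s.+1 ep vs sT; split=> //; rewrite andbT.
(* One endpoint below row [k * T.+1] already selects the branch of [strip] that ignores [o]. *)
by move: e; rewrite /strip_graph /strip [k * T.+1 <= u %/ k]leqNgt uT.
Qed.

Lemma strip_visible (k T : nat) (o o' : bool) (n : nat) (i w : 'I_n) :
  i < k * k -> visible (strip_graph k (k * T.+1) o (n := n)) T id i w ->
  visible (strip_graph k (k * T.+1) o' (n := n)) T id i w /\ w %/ k < k * T.+1.
Proof.
move=> ik [j [ji [p [pP <- pT]]]].
have jk : j %/ k < k * 1 by rewrite muln1 ltn_divLR; lia.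
have [p'P wT] := strip_path_eq o' pP jk pT; split=> //.
by exists j; split=> //; exists p.
Qed.

(** An algorithm is an arbitrary function of the view, so indistinguishable views must be made
    equal. *)
Lemma View_ext (V W : View) :
  vseq V = vseq W -> (forall x, vnodes V x <-> vnodes W x) ->
  (forall x y, vedges V x y <-> vedges W x y) -> V = W.
Proof.
case: V W => [s N E] [s' N' E'] /= -> HN HE; congr MkView.
- by apply: functional_extensionality => x; apply: propositional_extensionality.
- apply: functional_extensionality => x; apply: functional_extensionality => y.
  exact: propositional_extensionality.
Qed.

Lemma strip_view (k T : nat) (o o' : bool) (n : nat) (ids : 'I_n -> nat) (i : 'I_n) :
  i < k * k ->
  view (strip_graph k (k * T.+1) o (n := n)) T ids id i =
  view (strip_graph k (k * T.+1) o' (n := n)) T ids id i.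
Proof.
move=> ik; apply: View_ext => //= [x|x y].
  by split=> -[w [wP <-]]; exists w; split=> //; apply: (strip_visible _ ik wP).1.
have H q q' : (exists u w, [/\ visible (strip_graph k (k * T.+1) q (n := n)) T id i u,
    visible (strip_graph k (k * T.+1) q (n := n)) T id i w,
    strip_graph k (k * T.+1) q u w, ids u = x & ids w = y]) ->
   (exists u w, [/\ visible (strip_graph k (k * T.+1) q' (n := n)) T id i u,
    visible (strip_graph k (k * T.+1) q' (n := n)) T id i w,
    strip_graph k (k * T.+1) q' u w, ids u = x & ids w = y]).
  move=> [u [w [/(strip_visible q' ik)[uV uT] /(strip_visible q' ik)[wV _] e ux wy]]].
  exists u, w; split=> //.
  by move: e; rewrite /strip_graph /strip [k * T.+1 <= u %/ k]leqNgt uT.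
by split; apply: H.
Qed.

(** The extra edges make all rows, or all columns, of the window at [R] rainbow; [window_invariant]
    carries this verdict back to the first window. *)
Lemma strip_rainbow (k R n : nat) (o : bool) (h : 'I_n.+1 -> 'I_(2 * k - 2)) :
  1 < k -> (R + k) * k <= n.+1 ->
  (forall u v, strip_graph k R o u v -> h u != h v) ->
  (rainbow_rows (window (fun r (b : 'I_k) => h (inord (r * k + b))) 0) == set0) = ~~ o.
Proof.
move=> k1 Rn hP; set c := (fun r _ => _).
have k0 : 0 < k by apply: ltnW.
have cP r s (b d : 'I_k) : r < R + k -> s < R + k -> strip k R o (r * k + b) (s * k + d) ->
    c r b != c s d.
  move=> rR sR e; apply: hP; rewrite /strip_graph !inordK //.
  - by apply: leq_trans Rn; have := ltn_ord d; nia.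
  - by apply: leq_trans Rn; have := ltn_ord b; nia.
have rowE r (b : 'I_k) : (r * k + b) %/ k = r by rewrite divnMDl // divn_small ?addn0.
have colE r (b : 'I_k) : (r * k + b) %% k = b by rewrite modnMDl modn_small.
have WP j : j <= R -> grid_proper (window c j).
  move=> jR a a' b b'; rewrite -!val_eqE /= => na nb; apply: cP.
  - by have := ltn_ord a; lia.
  - by have := ltn_ord a'; lia.
  rewrite /strip !rowE !colE nb eqn_add2l na.
  have := ltn_ord a; have := ltn_ord a' => a1 a2.
  by apply/and3P; split; [lia|lia|case: ifP; case: (o)].
rewrite (window_invariant k0 WP).
have full (g : 'I_k -> 'I_k -> 'I_(2 * k - 2)) :
    (forall a b b', b != b' -> g a b != g a b') -> #|rainbow_rows g| = k.
  move=> gP; rewrite -[RHS](card_ord k) -cardsT; apply: eq_card => a; rewrite !inE.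
  by apply/injectiveP => b b' /eqP e; apply/eqP; apply: contraTT e => /gP.
have := rainbow_dichotomy k0 (WP R (leqnn R)).
have lt_R (a : 'I_k) : R + a < R + k by rewrite ltn_add2l.
case: o {hP} cP => cP /=.
- have xk : #|rainbow_rows (window c R)| = k.
    apply: full => a b b'; rewrite -val_eqE /= => nb; apply: cP => //.
    by rewrite /strip !rowE !colE nb leq_addr /=; apply/andP; split; lia.
  by rewrite -cards_eq0 xk eqn0Ngt k0.
- have yk : #|rainbow_rows (transpose (window c R))| = k.
    apply: full => b a a'; rewrite -val_eqE /= => na; apply: cP => //.
    have := ltn_ord a; have := ltn_ord a' => a1 a2.
    by rewrite /strip !rowE !colE eqn_add2l na !leq_addr /=; apply/and3P; split=> //; lia.
  by rewrite yk => -[[/cards0_eq -> _]|[k_eq0]]; [rewrite eqxx | rewrite k_eq0 in k0].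
Qed.

Theorem theorem3 :
  forall k : nat, 2 <= k ->
  forall c : nat, 1 <= c ->
  exists d n0 : nat, 0 < d /\
    forall n, n0 <= n ->
    forall (T : nat) (A : algorithm),
      solves_coloring k (2 * k - 2) n c T A -> n <= d * T.
Proof.
move=> k k1 c c1; have k0 : 0 < k by apply: ltnW.
(* The strip needs [k * k * (T + 2)] nodes: this is [2 * (k * k)] for [T = 0] and at most
   [3 * (k * k) * T] otherwise. *)
exists (3 * (k * k)), (2 * (k * k)); split; first by rewrite !muln_gt0 k0.
move=> n n0 T A sol; rewrite leqNgt; apply/negP => ltn.
have {n0 ltn} size_n : (k * T.+1 + k) * k <= n by case: T sol ltn => [|T] _ ltn; nia.
case: n sol size_n => [|n] sol size_n; first by nia.
pose ids (v : 'I_n.+1) := v.+1.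
have ids_inj : injective ids by move=> u v [/val_inj].
have idsP v : 1 <= ids v <= n.+1 ^ c.
  by rewrite /= (leq_trans (ltn_ord v)) // -[leqLHS]expn1 leq_pexp2l.
have S o := sol _ (strip_graph_simple k (k * T.+1) o n.+1)
  (strip_graph_kpartite (k * T.+1) o n.+1 k0) ids ids_inj idsP id (@inj_id _).
pose h o v := Ordinal ((S o).1 v).
have hP o u v : strip_graph k (k * T.+1) o u v -> h o u != h o v.
  by move=> /(S o).2.
(* The first window consists of the first [k * k] nodes presented, at which both strips give the
   same view. *)
have start_eq : window (fun r (b : 'I_k) => h true (inord (r * k + b))) 0
              = window (fun r (b : 'I_k) => h false (inord (r * k + b))) 0.
  apply: functional_extensionality => a; apply: functional_extensionality => b.
  apply: val_inj; rewrite /= (strip_view T true false) // inordK.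
    by have := ltn_ord a; have := ltn_ord b; nia.
  by apply: leq_trans size_n; have := ltn_ord a; have := ltn_ord b; nia.
have := strip_rainbow k1 size_n (hP true).
by rewrite start_eq (strip_rainbow k1 size_n (hP false)).
Qed.
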